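(* Let $d\ge 2$ be an integer. For every choice of coefficients $\lambda_n>0$ and $\beta_n\in\mathbb{R}$ ($n\ge 0$), the Jacobi operator $J$ on $\ell^2(\Lambda_d)$ is essentially selfadjoint.
   Context: $\Lambda_d$ is the vertex set of the infinite tree with one end and infinitely many origins: there is a length function $|\cdot|:\Lambda_d\to\mathbb{N}_0$ such that every vertex $x$ has exactly one successor $x_0$, with $|x_0|=|x|+1$; every vertex $x$ with $|x|\ge 1$ has exactly $d$ predecessors $x_1,\dots,x_d$ (the vertices whose successor is $x$, all of length $|x|-1$); vertices of length $0$ have no predecessor; the edges join each vertex to its successor and the resulting graph is connected (equivalently, any two vertices have a common iterated successor). $\ell^2(\Lambda_d)$ is the complex Hilbert space of square-summable functions on $\Lambda_d$, and $\delta_x$ is the characteristic function of $\{x\}$. The operator $J$ has domain $D(J)=\operatorname{lin}\{\delta_x: x\in\Lambda_d\}$ and acts by $$J\delta_x=\lambda_{n-1}(\delta_{x_1}+\dots+\delta_{x_d})+\beta_n\delta_x+\lambda_n\delta_{x_0},\qquad n=|x|,$$ where for $|x|=0$ the first term is absent (convention $\lambda_{-1}=0$). It is symmetric. A symmetric operator is essentially selfadjoint if its closure is selfadjoint. *)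

(* Defs.v *)
From HB Require Import structures.
From mathcomp Require Import all_boot all_order all_algebra.
From mathcomp Require Import zify.
From mathcomp Require Import complex finmap.
From mathcomp Require Import all_classical all_reals ereal esum numfun.

Set Implicit Arguments.
Unset Strict Implicit.
Unset Printing Implicit Defensive.
Import Order.TTheory GRing.Theory Num.Theory.
Local Open Scope classical_set_scope.
Local Open Scope ring_scope.
Local Open Scope complex_scope.
Local Open Scope card_scope.

Section Tree.
Variables (d : nat) (V : choiceType) (len : V -> nat) (succ : V -> V).

Definition tree_edge : rel V := fun x y => (y == succ x) || (x == succ y).

Definition predecessors (x : V) : set V := [set y | succ y = x].

Record one_ended_tree : Prop := OneEndedTree {
  tree_nonempty : [set: V] !=set0;
  tree_len_succ : forall x, len (succ x) = (len x).+1;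
  tree_predecessors : forall x, (1 <= len x)%N -> predecessors x #= `I_d;
  tree_origins : forall x, len x = 0 -> predecessors x = set0;
  tree_connected : forall x y, exists2 p, path tree_edge x p & last x p = y }.

End Tree.

Section SquareSummable.
Variables (R : realType) (V : choiceType).
Implicit Types f g : V -> R[i].

(* Valued in the extended reals: +oo outside l2. *)
Definition l2norm f : \bar R :=
  sqrte (\esum_(x in [set: V]) (Normc.normc (f x) ^+ 2)%:E).

Definition l2 : set (V -> R[i]) := [set f | (l2norm f < +oo)%E].

(* The sums of absolutely summable families indexed by V.  [esum] is only
   meaningful for nonnegative terms, hence the splitting into positive and
   negative parts; on other families these definitions carry no meaning. *)
Definition rsum (u : V -> R) : R :=
  fine (esum setT (EFin \o u)^\+ - esum setT (EFin \o u)^\-)%E.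

Definition csum (u : V -> R[i]) : R[i] :=
  rsum (fun x => complex.Re (u x)) +i* rsum (fun x => complex.Im (u x)).

Definition l2dot f g : R[i] := csum (fun x => f x * (g x)^*).

Definition delta (x : V) : V -> R[i] := fun y => (y == x)%:R.

End SquareSummable.

Arguments l2 {R V}.
Arguments delta {R V}.

(* Operators in l2 are given by their graphs, so that the closure and the
   adjoint always make sense. *)
Section Operators.
Variables (R : realType) (V : choiceType).
Local Notation H := (V -> R[i]).
Implicit Type T : set (H * H).

Definition graph (D : set H) (A : H -> H) : set (H * H) :=
  [set (f, A f) | f in D].

Definition domain T : set H := fst @` T.

Definition densely_defined T :=
  forall f : H, l2 f -> forall e : R, 0 < e ->
    exists2 h, domain T h & (l2norm (f - h)%R < e%:E)%E.

Definition op_closure T : set (H * H) := [set fg |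
  [/\ l2 fg.1, l2 fg.2 & forall e : R, 0 < e ->
    exists2 hk, T hk &
      (l2norm (fg.1 - hk.1)%R < e%:E)%E /\ (l2norm (fg.2 - hk.2)%R < e%:E)%E]].

Definition op_adjoint T : set (H * H) := [set gh |
  [/\ l2 gh.1, l2 gh.2 &
    forall fk, T fk -> l2dot fk.2 gh.1 = l2dot fk.1 gh.2]].

Definition symmetric_op T := densely_defined T /\ T `<=` op_adjoint T.

(* The adjoint of a densely defined relation is single-valued, so T is then
   the graph of an operator. *)
Definition selfadjoint_op T := densely_defined T /\ T = op_adjoint T.

Definition essentially_selfadjoint T :=
  symmetric_op T /\ selfadjoint_op (op_closure T).

End Operators.

Section Jacobi.
Variables (R : realType) (V : choiceType) (len : V -> nat) (succ : V -> V).
Variables (lam bet : nat -> R).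
Local Notation delta := (@delta R V).

Definition jacobi_domain : set (V -> R[i]) := [set f |
  exists s : seq (R[i] * V), f = \sum_(p <- s) p.1 *: delta p.2].

(* lambda_{n-1}, with lambda_{-1} = 0 *)
Definition lam_pred (n : nat) : R := if n is m.+1 then lam m else 0.

Definition jacobi_basis (x : V) : V -> R[i] :=
  (lam_pred (len x))%:C *: (\sum_(y \in predecessors succ x) delta y)
  + (bet (len x))%:C *: delta x + (lam (len x))%:C *: delta (succ x).

(* The linear extension of delta x |-> jacobi_basis x; the sum is finite for f
   in jacobi_domain. *)
Definition jacobi_fun (f : V -> R[i]) : V -> R[i] :=
  \sum_(x \in [set x | f x != 0]) f x *: jacobi_basis x.

Definition jacobi : set ((V -> R[i]) * (V -> R[i])) :=
  graph jacobi_domain jacobi_fun.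

Lemma jacobi_fun_delta x : jacobi_fun (delta x) = jacobi_basis x.
Proof.
rewrite /jacobi_fun (_ : [set y | _] = [set x]); last first.
  apply/seteqP; split => y /=; rewrite /delta; last by move=> ->; rewrite eqxx oner_eq0.
  by case: (y =P x) => //= _; rewrite eqxx.
by rewrite fsbig_set1 /delta eqxx scale1r.
Qed.

Lemma jacobi_domainP f : jacobi_domain f <-> finite_set [set x | f x != 0].
Proof.
have sumE (s : seq (R[i] * V)) y :
    (\sum_(p <- s) p.1 *: delta p.2) y = \sum_(p <- s | p.2 == y) p.1.
  elim: s => [|p s IH]; first by rewrite !big_nil.
  rewrite !big_cons fctE IH /=.
  have -> : (p.1 *: delta p.2) y = p.1 * (p.2 == y)%:R by rewrite eq_sym.
  by case: eqP => _; rewrite ?mulr1 // mulr0 add0r.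
split=> [[s ->]|fin].
  apply: (@sub_finite_set _ _ [set` [seq p.2 | p <- s]]); last exact: finite_seq.
  move=> y /=; rewrite sumE => /eqP nz; apply/negPn/negP => /negP yn; apply: nz.
  rewrite big1_seq // => p /andP[/eqP py ps]; case: yn.
  by rewrite -py; apply: map_f.
pose r := fset_set [set x | f x != 0].
exists [seq (f x, x) | x <- enum_fset r]; apply/funext => y.
rewrite sumE big_map /=; have [yr|yr] := boolP (y \in r).
  by rewrite -big_filter (@eq_filter _ _ (pred1 y)) // filter_pred1_uniq //= big_seq1.
rewrite big1_seq => [|x /andP[/eqP -> xr]]; last by rewrite xr in yr.
by move: yr; rewrite in_fset_set // notin_setE /= => /negP/negPn/eqP.
Qed.

Lemma jacobi_fun_linear a f g : jacobi_domain f -> jacobi_domain g ->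
  jacobi_fun (a *: f + g) = a *: jacobi_fun f + jacobi_fun g.
Proof.
move=> /jacobi_domainP Ff /jacobi_domainP Fg.
pose F := [set x | f x != 0] `|` [set x | g x != 0].
have FF : finite_set F by rewrite finite_setU.
have E h : [set x | h x != 0] `<=` F ->
    jacobi_fun h = \sum_(x \in F) h x *: jacobi_basis x.
  move=> hF; apply: fsbig_widen => // x [_ /= /negP/negPn/eqP ->].
  by rewrite scale0r.
have fgE x : (a *: f + g) x = a * f x + g x by [].
have Fl : [set x | (a *: f + g) x != 0] `<=` F.
  move=> x /=; rewrite fgE => nz; have [fx|fx] := eqVneq (f x) 0; last by left.
  by right; move: nz; rewrite fx mulr0 add0r.
rewrite !E //; [|by move=> x; right|by move=> x; left].
rewrite !fsbig_finite //= scaler_sumr -big_split /=; apply: eq_bigr => x _.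
by rewrite fgE scalerDl scalerA.
Qed.

End Jacobi.

(* The vertex (n, m) stands for the ray of digits of m in base d, the first
   digit being at position n; its successor drops that digit. *)
Lemma one_ended_tree_exists d : (2 <= d)%N ->
  one_ended_tree d (fun x : nat * nat => x.1)
                   (fun x : nat * nat => (x.1.+1, x.2 %/ d)%N).
Proof.
move=> d2; set succ := fun x : nat * nat => (x.1.+1, x.2 %/ d)%N.
split=> //; first by exists (0, 0)%N.
- move=> [[//|n] m] _; rewrite card_eq_sym.
  apply/(@pcard_eqP _ (nat * nat)%type); apply/bijPex.
  exists (fun r => (n, m * d + r)%N); split.
  + move=> r /= rd; rewrite /predecessors /succ /=.
    by rewrite divnMDl ?divn_small ?addn0 //; lia.
  + by move=> r1 r2 _ _ [] /addnI.
  + move=> [n' m'] /= [-> <-]; exists (m' %% d)%N; first by rewrite /= ltn_mod; lia.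
    by rewrite -divn_eq.
- by move=> [n m] /= ->; apply/seteqP; split => // -[].
have e_sym : symmetric (tree_edge succ).
  by move=> x y; rewrite /tree_edge orbC.
have to_axis n m : exists k, exists2 p,
    path (tree_edge succ) (n, m) p & last (n, m) p = (k, 0)%N.
  elim/ltn_ind: m n => -[|m] IH n; first by exists n, [::].
  have [|k [p pp lp]] := IH (m.+1 %/ d)%N _ n.+1; first by rewrite ltn_Pdiv.
  by exists k, (succ (n, m.+1) :: p) => //=; rewrite /tree_edge eqxx.
have axis k j : exists2 p,
    path (tree_edge succ) (k, 0)%N p & last (k, 0)%N p = ((k + j)%N, 0%N).
  elim: j k => [|j IH] k; first by exists [::]; rewrite ?addn0.
  have [p pp lp] := IH k.+1; exists ((k.+1, 0)%N :: p); last by rewrite /= lp addSnnS.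
  by rewrite /= pp /tree_edge /succ /= div0n eqxx.
have to_far n m : exists k0, forall k, (k0 <= k)%N -> exists2 p,
    path (tree_edge succ) (n, m) p & last (n, m) p = (k, 0)%N.
  have [k0 [p pp lp]] := to_axis n m; exists k0 => k /subnKC kE.
  have [q pq lq] := axis k0 (k - k0)%N; exists (p ++ q).
    by rewrite cat_path pp lp.
  by rewrite last_cat lp lq kE.
move=> [n m] [n' m'].
have [k far] := to_far n m; have [k' far'] := to_far n' m'.
have [p pp lp] := far _ (leq_maxl k k').
have [q pq lq] := far' _ (leq_maxr k k').
exists (p ++ rev (belast (n', m') q)).
  rewrite cat_path pp lp -lq rev_path.
  by rewrite (eq_path (e' := tree_edge succ)) // => x y; rewrite e_sym.
rewrite last_cat lp -lq; case: q {pq lq} => //= y q.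
by rewrite rev_cons last_rcons.
Qed.

(* Main.v *)
Require Import Defs.
From mathcomp Require Import all_boot all_order all_algebra.
From mathcomp Require Import zify ring lra.
From mathcomp Require Import complex finmap.
From mathcomp Require Import all_classical all_reals ereal esum.

(** For a vertex x, let A_x g be the function on the finite subtree
    below x obtained by averaging g over each level of that subtree, and let
    C_x g be g - A_x g on that subtree and 0 outside.  As C_x g vanishes at x
    and the sum of its values over the d predecessors of x is 0, the operator
    C_x commutes with the formal action of J on all functions; its values have
    finite support.  The complement 1 - C_x is a contraction of l2 by
    Cauchy-Schwarz, and the square of its norm on delta_p is d^-k for p lying
    k levels below x.  Hence, letting x run along the ray of iterated
    successors of a fixed vertex, C_x tends strongly to 1 because d >= 2.  If
    (g, h) is in the graph of the adjoint of J, then h is the formal image of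
    g, so (C_x g, C_x h) is in the graph of J and tends to (g, h). *)

Set Implicit Arguments.
Unset Strict Implicit.
Unset Printing Implicit Defensive.
Import Order.TTheory GRing.Theory Num.Theory.
Local Open Scope classical_set_scope.
Local Open Scope ring_scope.
Local Open Scope complex_scope.

(** * Elementary inequalities and finite sums *)

Lemma addr_norm_ge0 (R : realDomainType) (x : R) : 0 <= x + `|x|.
Proof. by have := ler_norm (- x); rewrite normrN; lra. Qed.

Lemma sum_uniq_eq (K : nmodType) (T : eqType) (s : seq T) x (c : K) :
  uniq s -> \sum_(y <- s) (if y == x then c else 0) = if x \in s then c else 0.
Proof.
elim: s => [|y s IH] /=; first by rewrite big_nil.
move=> /andP[ys us]; rewrite big_cons in_cons IH//.
case: (eqVneq y x) => [<-|yx]; rewrite ?add0r//=.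
by rewrite (negbTE ys) addr0 ?eqxx.
Qed.

Lemma sumr_const_seq (K : nmodType) (T : Type) (s : seq T) (c : K) :
  \sum_(i <- s) c = c *+ size s.
Proof. by rewrite big_const_seq count_predT iter_addr_0. Qed.

(** Cauchy-Schwarz against the constant vector 1; the contraction estimate for averages rests on
    it. *)
Lemma sqr_sum_le (R : realFieldType) (T : Type) (s : seq T) (F : T -> R) :
  (\sum_(i <- s) F i) ^+ 2 <= (size s)%:R * \sum_(i <- s) F i ^+ 2.
Proof.
elim: s => [|i s IH]; first by rewrite !big_nil expr0n mul0r.
rewrite !big_cons /= -natr1; move: IH.
set S := \sum_(j <- s) F j; set T2 := \sum_(j <- s) F j ^+ 2.
have T0 : 0 <= T2 by apply: sumr_ge0 => j _; exact: sqr_ge0.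
case: s @S @T2 T0 => [|j s] S T2 T0 IH.
  by rewrite /S /T2 !big_nil addr0 add0r addr0 mul1r.
move: IH; have : 0 < (size (j :: s))%:R :> R by rewrite ltr0n.
move: (size _)%:R (F i) => n a n0 IH.
(* After multiplication by the positive [n], the difference of the two sides equals a square plus
   [n + 1] times the slack of the induction hypothesis. *)
rewrite -(ler_pM2l n0) -subr_ge0.
apply: (@le_trans _ _ ((n * a - S) ^+ 2 + (n + 1) * (n * T2 - S ^+ 2))).
  by rewrite addr_ge0 ?sqr_ge0// mulr_ge0 ?subr_ge0// addr_ge0// ltW.
by rewrite le_eqVlt; apply/orP; left; apply/eqP; ring.
Qed.

(** The squared norm of the constant [d ^- k] on a level of [d ^ k] vertices. *)
Lemma natr_mul_invX_sqr (K : numFieldType) (d k : nat) : (0 < d)%N ->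
  (d ^ k)%:R * (d%:R ^- k) ^+ 2 = d%:R ^- k :> K.
Proof. by move=> d0; rewrite natrX expr2 mulVKf ?expf_neq0// pnatr_eq0 -lt0n. Qed.

(** * Real sums over the vertex set *)

Section RealSums.
Variables (R : realType) (V : choiceType).
Implicit Types u v a b : V -> R.

Definition tot u : \bar R := \esum_(x in [set: V]) (u x)%:E.

Definition abs_summable u := (tot (fun x => `|u x|)%R < +oo)%E.

Lemma tot_ge0 a : (forall x, 0 <= a x) -> (0 <= tot a)%E.
Proof. by move=> a0; apply: esum_ge0 => x _; rewrite lee_fin. Qed.

Lemma le_tot a b : (forall x, a x <= b x) -> (tot a <= tot b)%E.
Proof. by move=> ab; apply: le_esum => x _; rewrite lee_fin. Qed.

Lemma totD a b : (forall x, 0 <= a x) -> (forall x, 0 <= b x) ->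
  tot (fun x => a x + b x) = (tot a + tot b)%E.
Proof.
by move=> a0 b0; rewrite /tot -esumD// => x _; rewrite lee_fin.
Qed.

Lemma le_fine_tot a b : (forall x, 0 <= a x) -> (forall x, a x <= b x) ->
  (tot b < +oo)%E -> fine (tot a) <= fine (tot b).
Proof.
move=> a0 ab bfin; apply: fine_le; rewrite ?ge0_fin_numE//; [| | |exact: le_tot].
- by apply: le_lt_trans bfin; exact: le_tot.
- exact: tot_ge0.
- by apply: tot_ge0 => x; exact: le_trans (ab x).
Qed.

Lemma fine_totD a b : (forall x, 0 <= a x) -> (forall x, 0 <= b x) ->
  (tot a < +oo)%E -> (tot b < +oo)%E ->
  fine (tot (fun x => a x + b x)) = fine (tot a) + fine (tot b).
Proof.
by move=> a0 b0 af bf; rewrite totD// fineD// ge0_fin_numE// tot_ge0.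
Qed.

Lemma tot_ltyD a b : (forall x, 0 <= a x) -> (forall x, 0 <= b x) ->
  (tot a < +oo)%E -> (tot b < +oo)%E -> (tot (fun x => a x + b x)%R < +oo)%E.
Proof. by move=> a0 b0 af bf; rewrite totD// lte_add_pinfty. Qed.

(** Finite partial sums give one inequality for a positive factor; the other is the same inequality
    for the factor [c^-1]. *)
Lemma totZ c a : 0 <= c -> (forall x, 0 <= a x) ->
  tot (fun x => c * a x) = (c%:E * tot a)%E.
Proof.
have le_tot_scale t b : 0 < t -> (forall x, 0 <= b x) ->
    (tot (fun x => t * b x)%R <= t%:E * tot b)%E.
  move=> t0 b0; rewrite /tot/esum; apply: ge_ereal_sup => _ [A [Af AT] <-].
  rewrite fsbig_finite//=.
  under eq_bigr do rewrite EFinM.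
  rewrite -ge0_sume_distrr => [|x _]; last by rewrite lee_fin.
  rewrite lee_pmul2l//; apply: ereal_sup_ubound.
  by exists A => //; rewrite fsbig_finite.
rewrite le_eqVlt => /predU1P[<- a0|c0 a0].
  by rewrite mul0e /tot esum1// => x _; rewrite mul0r.
apply/eqP; rewrite eq_le le_tot_scale//=.
rewrite -lee_pdivlMl//.
have -> : tot a = tot (fun x => c^-1 * (c * a x)).
  by congr tot; apply/funext => x; rewrite mulKf// gt_eqF.
by apply: le_tot_scale => [|x]; rewrite ?invr_gt0// mulr_ge0// ltW.
Qed.

Lemma tot_ltyZ c a : 0 <= c -> (forall x, 0 <= a x) ->
  (tot a < +oo)%E -> (tot (fun x => c * a x)%R < +oo)%E.
Proof.
by move=> c0 a0 af; rewrite totZ// -ge0_fin_numE ?fin_numM ?mule_ge0 ?tot_ge0//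
  ge0_fin_numE ?tot_ge0.
Qed.

Lemma tot_single a x : (forall y, 0 <= a y) -> (forall y, y != x -> a y = 0) ->
  tot a = (a x)%:E.
Proof.
move=> a0 ax; transitivity (\esum_(y in [set x]) (a y)%:E).
  2: by rewrite esum_set1// lee_fin.
rewrite [RHS]esum_mkcond /tot; apply: eq_esum => y _; rewrite in_set1/=.
by case: eqVneq => // /ax ->.
Qed.

(** Frees [rsum] from the positive and negative parts of its definition: any splitting into
    nonnegative summable families gives the same value. *)
Lemma rsum_posneg a b : (forall x, 0 <= a x) -> (forall x, 0 <= b x) ->
  (tot a < +oo)%E -> (tot b < +oo)%E ->
  rsum (fun x => a x - b x) = fine (tot a) - fine (tot b).
Proof.
move=> a0 b0 af bf; rewrite /rsum.
have sm c : (forall x, 0 <= c x) -> (tot c < +oo)%E ->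
    summable setT (EFin \o c).
  move=> c0; rewrite /summable; congr (_ < _)%E; apply: eq_esum => x _ /=.
  by rewrite ger0_norm.
have -> : EFin \o (fun x => a x - b x) = ((EFin \o a) \- (EFin \o b))%E.
  by apply/funext.
rewrite esumB//; do ?exact: sm; try by move=> x _; rewrite /= lee_fin.
by rewrite -/(tot a) -/(tot b) fineB// ge0_fin_numE// tot_ge0.
Qed.

Lemma tot_add_norm_lty u : abs_summable u ->
  (tot (fun x => u x + `|u x|)%R < +oo)%E.
Proof.
move=> us; have : (tot (fun x => `|u x| + `|u x|)%R < +oo)%E by exact: tot_ltyD.
by apply: le_lt_trans; apply: le_tot => x; rewrite lerD2r ler_norm.
Qed.

(* Writing u = (u + |u|) - |u| keeps both terms nonnegative and additive in the
   pair (u, |u|), unlike the positive and negative parts. *)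
Lemma rsumE u : abs_summable u ->
  rsum u = fine (tot (fun x => u x + `|u x|)) - fine (tot (fun x => `|u x|)).
Proof.
move=> us; rewrite -rsum_posneg//.
- by congr rsum; apply/funext => x; rewrite addrK.
- by move=> x; exact: addr_norm_ge0.
- exact: tot_add_norm_lty.
Qed.

Lemma rsumD u v : abs_summable u -> abs_summable v ->
  rsum (fun x => u x + v x) = rsum u + rsum v.
Proof.
move=> us vs.
have ge (w : V -> R) x : 0 <= w x + `|w x| by exact: addr_norm_ge0.
rewrite (rsumE us) (rsumE vs) addrACA -opprD.
rewrite -!fine_totD//; do ?exact: tot_add_norm_lty.
rewrite -rsum_posneg.
- by congr rsum; apply/funext => x; ring.
- by move=> x; rewrite addr_ge0.
- by move=> x; rewrite addr_ge0.
- by apply: tot_ltyD => //; exact: tot_add_norm_lty.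
- exact: tot_ltyD.
Qed.

Lemma rsumN u : abs_summable u -> rsum (fun x => - u x) = - rsum u.
Proof.
move=> us; rewrite (rsumE us) opprB -rsum_posneg//.
- by congr rsum; apply/funext => x; ring.
- by move=> x; exact: addr_norm_ge0.
- exact: tot_add_norm_lty.
Qed.

Lemma rsum_le u b : (forall x, `|u x| <= b x) -> (tot b < +oo)%E ->
  `|rsum u| <= fine (tot b).
Proof.
move=> ub bf.
have us : abs_summable u by apply: le_lt_trans bf; exact: le_tot.
have b0 x : 0 <= b x by exact: le_trans (ub x).
apply: (@le_trans _ _ (fine (tot (fun x => `|u x|)))); last exact: le_fine_tot.
have ge x : 0 <= u x + `|u x| by exact: addr_norm_ge0.
have uu_lty : (tot (fun x => `|u x| + `|u x|)%R < +oo)%E by exact: tot_ltyD.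
(* The sum of [u] is the sum of [u + |u|] minus that of [|u|]. As the former lies between 0 and
   twice the latter, the difference is bounded by the sum of [|u|]. *)
have le2 : fine (tot (fun x => u x + `|u x|)) <= fine (tot (fun x => `|u x|)) *+ 2.
  rewrite mulr2n -fine_totD//; apply: le_fine_tot => // x.
  by rewrite lerD2r ler_norm.
have ge0 : 0 <= fine (tot (fun x => u x + `|u x|)) by rewrite fine_ge0 ?tot_ge0.
by rewrite rsumE// ler_norml; move: le2 ge0; lra.
Qed.

Lemma rsum_single u x : (forall y, y != x -> u y = 0) -> rsum u = u x.
Proof.
move=> u0.
have us : abs_summable u.
  by rewrite /abs_summable (@tot_single _ x) ?ltry// => y /u0 ->; rewrite normr0.
rewrite rsumE// !(@tot_single _ x)//=; first by rewrite addrK.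
- by move=> y /u0 ->; rewrite normr0.
- by move=> y; exact: addr_norm_ge0.
- by move=> y /u0 ->; rewrite normr0 addr0.
Qed.

Lemma abs_summableZ c u : abs_summable u -> abs_summable (fun x => c * u x).
Proof.
move=> us; rewrite /abs_summable (_ : (fun x => _) = (fun x => `|c| * `|u x|)).
  exact: tot_ltyZ.
by apply/funext => x; rewrite normrM.
Qed.

Lemma rsumZ c u : abs_summable u -> rsum (fun x => c * u x) = c * rsum u.
Proof.
wlog c0 : c / 0 <= c => [hwlog us|us].
  have [/hwlog->//|c0] := leP 0 c.
  have := hwlog (- c); rewrite oppr_ge0 => /(_ (ltW c0) us) E.
  rewrite -[LHS]opprK -rsumN; last exact: abs_summableZ.
  rewrite -[RHS]opprK -mulNr -E; congr (- rsum _); apply/funext => x.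
  by rewrite mulNr.
have ge x : 0 <= u x + `|u x| by exact: addr_norm_ge0.
have sum_lty := tot_add_norm_lty us.
rewrite (rsumE us) mulrBr.
have fineZ a : (forall x : V, 0 <= a x) -> (tot a < +oo)%E ->
    c * fine (tot a) = fine (tot (fun x => c * a x)).
  by move=> a0 af; rewrite totZ// fineM// ge0_fin_numE// tot_ge0.
rewrite !fineZ// -rsum_posneg.
- by congr rsum; apply/funext => x; ring.
- by move=> x; rewrite mulr_ge0.
- by move=> x; rewrite mulr_ge0.
- exact: tot_ltyZ.
- exact: tot_ltyZ.
Qed.

End RealSums.

(** * Norm and inner product of l2 *)

Section L2.
Variables (R : realType) (V : choiceType).
Local Notation H := (V -> R[i]).
Implicit Types f g h : H.
Local Notation Re := complex.Re.
Local Notation Im := complex.Im.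

Definition sqn (z : R[i]) : R := Normc.normc z ^+ 2.

Lemma sqnE (z : R[i]) : sqn z = Re z ^+ 2 + Im z ^+ 2.
Proof. by case: z => a b; rewrite /sqn/= sqr_sqrtr// addr_ge0 ?sqr_ge0. Qed.

Lemma sqn_ge0 (z : R[i]) : 0 <= sqn z.
Proof. exact: sqr_ge0. Qed.

Lemma sqn0 : sqn 0 = 0.
Proof. by rewrite sqnE/= expr0n addr0. Qed.

Lemma sqnM (z w : R[i]) : sqn (z * w) = sqn z * sqn w.
Proof. by case: z w => a b [c e]; rewrite !sqnE/=; ring. Qed.

Lemma sqn_natr n : sqn n%:R = n%:R ^+ 2.
Proof.
have -> : (n%:R : R[i]) = (n%:R)%:C by rewrite rmorph_nat.
by rewrite sqnE/= expr0n addr0.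
Qed.

Lemma sqnD_le (z w : R[i]) : sqn (z + w) <= 2 * sqn z + 2 * sqn w.
Proof. case: z w => a b [c e]; rewrite !sqnE/=.
by have := sqr_ge0 (a - c); have := sqr_ge0 (b - e); lra. Qed.

(** Squared norms are plain sums over vertices, so pointwise estimates carry over to them;
    [l2norm_lt] translates back to [l2norm]. *)
Definition nsq f : \bar R := tot (fun x => sqn (f x)).

Lemma nsq_ge0 f : (0 <= nsq f)%E.
Proof. by apply: tot_ge0 => x; exact: sqn_ge0. Qed.

Lemma l2normE f : l2norm f = sqrte (nsq f).
Proof. by []. Qed.

Lemma l2P f : l2 f <-> (nsq f < +oo)%E.
Proof.
rewrite /l2/= l2normE -!ge0_fin_numE ?sqrte_ge0 ?nsq_ge0//.
by rewrite sqrte_fin_num ?nsq_ge0.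
Qed.

Lemma l2norm_lt f (e : R) : 0 < e ->
  (l2norm f < e%:E)%E = (nsq f < (e ^+ 2)%:E)%E.
Proof.
move=> e0; rewrite l2normE [LHS]ltNge [RHS]ltNge; congr (~~ _).
rewrite -(@lee_sqrt _ ((e ^+ 2)%:E))  ?nsq_ge0//=.
by rewrite sqrtr_sqr gtr0_norm.
Qed.

(** Stands in for the triangle inequality; the factor 2 is harmless where only smallness matters. *)
Lemma nsqD_le f g : (nsq (f + g)%R <= 2%:E * nsq f + 2%:E * nsq g)%E.
Proof.
have s0 (h : H) x : 0 <= 2 * sqn (h x) by rewrite mulr_ge0// sqn_ge0.
rewrite -!totZ//; do ?by move=> x; exact: sqn_ge0.
rewrite -totD//; do ?by move=> x; exact: s0.
by apply: le_tot => x; exact: sqnD_le.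
Qed.

Lemma nsqZ c f : nsq (c *: f)%R = ((sqn c)%:E * nsq f)%E.
Proof.
rewrite -totZ ?sqn_ge0// => [|x]; last exact: sqn_ge0.
by congr tot; apply/funext => x; rewrite -sqnM.
Qed.

Lemma l2D f g : l2 f -> l2 g -> l2 (f + g).
Proof.
move=> /l2P fl /l2P gl; apply/l2P; apply: le_lt_trans (nsqD_le f g) _.
have fin h : (nsq h < +oo)%E -> (2%:E * nsq h < +oo)%E.
  by move=> hl; rewrite lte_mul_pinfty// lee_fin.
by rewrite lte_add_pinfty// fin.
Qed.

Lemma l2Z c f : l2 f -> l2 (c *: f).
Proof.
move=> /l2P fl; apply/l2P; rewrite nsqZ.
by rewrite lte_mul_pinfty// lee_fin sqn_ge0.
Qed.

Lemma l2_0 : l2 (0 : H).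
Proof. by apply/l2P; rewrite /nsq/tot esum1// => x _; rewrite sqn0. Qed.

Lemma l2N f : l2 f -> l2 (- f).
Proof. by rewrite -scaleN1r; exact: l2Z. Qed.

Lemma l2B f g : l2 f -> l2 g -> l2 (f - g).
Proof. by move=> fl gl; apply: l2D => //; exact: l2N. Qed.

Lemma l2_delta x : l2 (delta x : H).
Proof.
apply/l2P; rewrite /nsq (@tot_single _ _ _ x) ?ltry// => [y|y /negbTE yx].
  exact: sqn_ge0.
by rewrite /delta yx sqn0.
Qed.

(** Completing the square. The free weight [e] lets [l2dot_small] do the work of a Cauchy-Schwarz
    inequality for infinite sums. *)
Lemma young (e a b : R) : 0 < e -> `|a * b| <= (e^-1 * a ^+ 2 + e * b ^+ 2) / 2.
Proof.
move=> e0; rewrite normrM -(real_normK (num_real a)) -(real_normK (num_real b)).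
move: `|a| `|b| => {}a {}b.
have -> : (e^-1 * a ^+ 2 + e * b ^+ 2) / 2 = a * b + e^-1 * (a - e * b) ^+ 2 / 2.
  by field; rewrite gt_eqF.
by rewrite lerDl divr_ge0// mulr_ge0 ?sqr_ge0// invr_ge0 ltW.
Qed.

Lemma Re_mulJ_le (e : R) (z w : R[i]) : 0 < e ->
  `|Re (z * w^*)| <= e^-1 * sqn z + e * sqn w.
Proof.
case: z w => a b [c d] e0; rewrite !sqnE/=.
have -> : a * c - b * - d = a * c + b * d by ring.
apply: le_trans (ler_normD _ _) _.
have := young a c e0; have := young b d e0.
have : 0 < e^-1 by rewrite invr_gt0.
by nra.
Qed.

Lemma Im_mulJ_le (e : R) (z w : R[i]) : 0 < e ->
  `|Im (z * w^*)| <= e^-1 * sqn z + e * sqn w.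
Proof.
case: z w => a b [c d] e0; rewrite !sqnE/=.
apply: le_trans (ler_normD _ _) _; rewrite mulrN normrN.
have := young a d e0; have := young b c e0.
have : 0 < e^-1 by rewrite invr_gt0.
by nra.
Qed.

Lemma young_lty (e : R) f g : 0 < e -> l2 f -> l2 g ->
  (tot (fun x => e^-1 * sqn (f x) + e * sqn (g x))%R < +oo)%E.
Proof.
move=> e0 /l2P fl /l2P gl; have e0' : 0 <= e^-1 by rewrite invr_ge0 ltW.
apply: tot_ltyD => [x|x||]; do ?by rewrite mulr_ge0 ?sqn_ge0// ltW.
  by apply: tot_ltyZ => // x; exact: sqn_ge0.
by apply: tot_ltyZ => [|x|]; rewrite ?sqn_ge0// ltW.
Qed.

Lemma Re_mulJ_summable f g : l2 f -> l2 g ->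
  abs_summable (fun x => Re (f x * (g x)^*)).
Proof.
move=> fl gl; apply: le_lt_trans (young_lty ltr01 fl gl).
by apply: le_tot => x; exact: Re_mulJ_le.
Qed.

Lemma Im_mulJ_summable f g : l2 f -> l2 g ->
  abs_summable (fun x => Im (f x * (g x)^*)).
Proof.
move=> fl gl; apply: le_lt_trans (young_lty ltr01 fl gl).
by apply: le_tot => x; exact: Im_mulJ_le.
Qed.

Lemma complex_ext (z w : R[i]) : Re z = Re w -> Im z = Im w -> z = w.
Proof. by case: z w => a b [c d] /= -> ->. Qed.

Lemma l2dotDl f g h : l2 f -> l2 g -> l2 h ->
  l2dot (f + g) h = l2dot f h + l2dot g h.
Proof.
move=> fl gl hl; apply: complex_ext; rewrite /l2dot/csum/=.
  rewrite -rsumD; do ?exact: Re_mulJ_summable.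
  by congr rsum; apply/funext => x; rewrite mulrDl raddfD.
rewrite -rsumD; do ?exact: Im_mulJ_summable.
by congr rsum; apply/funext => x; rewrite mulrDl raddfD.
Qed.

Lemma l2dotC f g : l2 f -> l2 g -> l2dot g f = (l2dot f g)^*.
Proof.
move=> fl gl; rewrite /l2dot/csum/= -rsumN; last exact: Im_mulJ_summable.
congr (_ +i* _); congr rsum; apply/funext => x.
  by case: (f x) (g x) => a b [c d] /=; ring.
by case: (f x) (g x) => a b [c d] /=; ring.
Qed.

Lemma l2dot_single f g x : (forall y, y != x -> f y = 0) ->
  l2dot f g = f x * (g x)^*.
Proof.
move=> f0; apply: complex_ext; rewrite /l2dot/csum/=.
  by rewrite (@rsum_single _ _ _ x)// => y /f0 ->; rewrite mul0r.
by rewrite (@rsum_single _ _ _ x)// => y /f0 ->; rewrite mul0r.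
Qed.

(** Continuity of the inner product in its first argument. With weight [e], the termwise bounds add
    up to [e^-1 * nsq f + e * nsq g], and the first term is below [e] because [nsq f < e ^+ 2]. *)
Lemma l2dot_small (e : R) f g : 0 < e -> (nsq f < (e ^+ 2)%:E)%E -> l2 g ->
  `|Re (l2dot f g)| <= e * (1 + fine (nsq g)) /\
  `|Im (l2dot f g)| <= e * (1 + fine (nsq g)).
Proof.
move=> e0 fe gl.
have fl : l2 f by apply/l2P; apply: lt_trans fe _; rewrite ltry.
have e0' : 0 <= e^-1 by rewrite invr_ge0 ltW.
have yl := young_lty e0 fl gl.
have sum_le : fine (tot (fun x => e^-1 * sqn (f x) + e * sqn (g x))%R)
    <= e * (1 + fine (nsq g)).
  have [/l2P ff /l2P gf] := (fl, gl).
  rewrite fine_totD; last 4 first.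
  - by move=> x; rewrite mulr_ge0 ?sqn_ge0.
  - by move=> x; rewrite mulr_ge0 ?sqn_ge0// ltW.
  - by apply: tot_ltyZ => // x; exact: sqn_ge0.
  - by apply: tot_ltyZ => [|x|]; rewrite ?sqn_ge0// ltW.
  rewrite !totZ ?(ltW e0)//; do ?by move=> x; exact: sqn_ge0.
  rewrite -/(nsq f) -/(nsq g).
  rewrite !fineM ?ge0_fin_numE ?nsq_ge0 ?ltry ?lee_fin ?(ltW e0)//=.
  rewrite mulrDr mulr1 lerD2r.
  rewrite ler_pdivrMl//= -expr2 -lee_fin fineK ?ge0_fin_numE ?nsq_ge0//.
  exact: ltW.
split; apply: le_trans sum_le; rewrite /l2dot/csum/=; apply: rsum_le => // x.
  exact: Re_mulJ_le.
exact: Im_mulJ_le.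
Qed.

Lemma l2dotZl c f g : l2 f -> l2 g -> l2dot (c *: f) g = c * l2dot f g.
Proof.
move=> fl gl; case: c => a b.
have rs := Re_mulJ_summable fl gl; have is_ := Im_mulJ_summable fl gl.
apply: complex_ext; rewrite /l2dot/csum/=.
  rewrite -mulNr -!rsumZ// -rsumD; do ?exact: abs_summableZ.
  congr rsum; apply/funext => x; rewrite fctE /= [_ *: _]/(_ * _) -mulrA.
  by case: (f x * (g x)^*) => p q /=; ring.
rewrite -!rsumZ// -rsumD; do ?exact: abs_summableZ.
congr rsum; apply/funext => x; rewrite fctE /= [_ *: _]/(_ * _) -mulrA.
by case: (f x * (g x)^*) => p q /=; ring.
Qed.

Lemma l2dot_delta x g : l2dot (delta x) g = (g x)^*.
Proof.
rewrite (@l2dot_single _ _ x) => [|y /negbTE yx]; rewrite /delta ?yx//.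
by rewrite eqxx mul1r.
Qed.

Lemma l2_sum (I : Type) (s : seq I) (F : I -> H) :
  (forall i, l2 (F i)) -> l2 (\sum_(i <- s) F i).
Proof. by move=> Fl; apply: big_ind => //; [exact: l2_0|exact: l2D]. Qed.

Lemma l2dot_suml (I : Type) (s : seq I) (F : I -> H) g :
  (forall i, l2 (F i)) -> l2 g ->
  l2dot (\sum_(i <- s) F i) g = \sum_(i <- s) l2dot (F i) g.
Proof.
move=> Fl gl; elim: s => [|i s IH].
  2: by rewrite !big_cons l2dotDl ?IH//; exact: l2_sum.
rewrite !big_nil -[X in l2dot X](scale0r (0 : H)) l2dotZl ?mul0r//; exact: l2_0.
Qed.

Lemma jacobi_domain_l2 f : jacobi_domain f -> l2 f.
Proof. by move=> [s ->]; apply: l2_sum => p; apply: l2Z; exact: l2_delta. Qed.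

Lemma jacobi_domain_delta x : jacobi_domain (delta x : H).
Proof. by exists [:: (1, x)]; rewrite big_seq1 scale1r. Qed.

(** [nsq g] is a supremum of finite partial sums. Truncating [g] to a finite set whose partial sum
    is within [e] of it leaves a tail of squared norm below [e]. *)
Lemma finite_approx g (e : R) : l2 g -> 0 < e ->
  exists2 f, jacobi_domain f & (nsq (g - f)%R < e%:E)%E.
Proof.
move=> /l2P gl e0.
have gf : nsq g \is a fin_num by rewrite ge0_fin_numE ?nsq_ge0.
have [_ [A [Af _] <-] ltA] := ub_ereal_sup_adherent e0 gf.
exists (fun x => if x \in A then g x else 0).
  apply/jacobi_domainP; apply: sub_finite_set Af => x /=.
  by case: ifPn => [/set_mem//|_]; rewrite eqxx.
have Epos x : setT x -> (0 <= (sqn (g x))%:E)%E by rewrite lee_fin sqn_ge0.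
have E : nsq g = (\sum_(x \in A) (sqn (g x))%:E +
    nsq (g - (fun x => if x \in A then g x else 0))%R)%E.
  rewrite {1}/nsq/tot (esumID A)// setTI; congr (_ + _)%E.
    by rewrite esum_fset// => x _; exact: Epos.
  rewrite setTI esum_mkcond; apply: eq_esum => x _.
  rewrite in_setC !fctE; case: ifPn; case: ifPn => //= _ _.
  - by rewrite subr0.
  - by rewrite subrr sqn0.
move: gf ltA; rewrite -[ereal_sup _]/(nsq g) E.
have : (0 <= \sum_(x \in A) (sqn (g x))%:E)%E.
  by apply: fsume_ge0 => x _; exact: Epos.
have := nsq_ge0 (g - (fun x => if x \in A then g x else 0))%R.
case: (nsq _) => [r||]//; case: (\sum_(x \in A) _)%E => [t||]// _ _ _.
rewrite /= !lte_fin; lra.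
Qed.

(** * Closures and adjoints of graphs *)

Lemma op_closureS (T : set (H * H)) :
  (forall fk, T fk -> l2 fk.1 /\ l2 fk.2) -> T `<=` op_closure T.
Proof.
move=> Tl fk Tfk; have [fl kl] := Tl _ Tfk; split => // e e0; exists fk => //.
by rewrite !subrr !l2norm_lt// /nsq/tot !esum1 ?lte_fin ?exprn_gt0// => x _;
  rewrite sqn0.
Qed.

(** The defining identity of the adjoint passes to limits by continuity of the inner product. *)
Lemma op_adjoint_closure (T : set (H * H)) :
  (forall fk, T fk -> l2 fk.1 /\ l2 fk.2) ->
  op_adjoint (op_closure T) = op_adjoint T.
Proof.
move=> Tl; apply/seteqP; split => -[g k] [/= gl kl adj]; split => //= -[f h].
  by move=> /(op_closureS Tl)/adj.
move=> [/= fl hl] /= approx.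
(* The sum of the constants [1 + fine (nsq g)] and [1 + fine (nsq k)] that [l2dot_small] yields for
   the two inner products. *)
pose C := 2 + fine (nsq g) + fine (nsq k).
have C0 : 0 < C.
  by rewrite /C -addrA ltr_wpDr// addr_ge0// fine_ge0// nsq_ge0.
suff small (e : R) : 0 < e ->
    `|Re (l2dot h g - l2dot f k)| <= e * C /\
    `|Im (l2dot h g - l2dot f k)| <= e * C.
  have small0 (a : R) : (forall e : R, 0 < e -> `|a| <= e * C) -> a = 0.
    move=> ae; apply/eqP; rewrite -normr_le0; apply/ler_addgt0Pr => e e0.
    rewrite add0r.
    by rewrite -(divfK (lt0r_neq0 C0) e) ae// divr_gt0.
  apply/eqP; rewrite -subr_eq0; apply/eqP.
  apply: complex_ext; apply: small0 => e /small[]//.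
move=> e0; have [[f' h'] Tf' []] := approx _ e0.
rewrite !l2norm_lt// => fe he; have [f'l h'l] := Tl _ Tf'.
have -> : l2dot h g - l2dot f k = l2dot (h - h') g - l2dot (f - f') k.
  have split (u u' v : H) : l2 u -> l2 u' -> l2 v ->
      l2dot u v = l2dot (u - u') v + l2dot u' v.
    by move=> ul ul' vl; rewrite -l2dotDl ?subrK//; exact: l2B.
  rewrite (split h h') // (split f f')// (adj _ Tf')/=; ring.
have [r1 i1] := l2dot_small e0 he gl; have [r2 i2] := l2dot_small e0 fe kl.
have eC : e * (1 + fine (nsq g)) + e * (1 + fine (nsq k)) = e * C.
  by rewrite /C; ring.
rewrite !raddfB/=; split; apply: le_trans (ler_normB _ _) _; rewrite -eC.
  exact: lerD r1 r2.
exact: lerD i1 i2.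
Qed.

(** The symmetry identity is extended to the closure one argument at a time: [op_adjoint_closure]
    serves for each, with a conjugation in between to exchange the arguments. *)
Lemma op_closure_sub_adjoint (T : set (H * H)) :
  T `<=` op_adjoint T -> op_closure T `<=` op_adjoint (op_closure T).
Proof.
move=> Tsym; have Tl fk : T fk -> l2 fk.1 /\ l2 fk.2 by move=> /Tsym[].
rewrite op_adjoint_closure// => -[g k] cgk; have [/= gl kl _] := cgk.
split => //= -[f h] Tfh /=; have [fl hl] := Tl _ Tfh; move: (Tsym _ Tfh).
rewrite -op_adjoint_closure// => -[_ _ /(_ _ cgk)/= E].
by rewrite (l2dotC gl hl) (l2dotC kl fl) E.
Qed.

End L2.

(** * The formal action of J on arbitrary functions *)

Section FormalJacobi.
Variables (R : realType) (d : nat) (V : choiceType).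
Variables (len : V -> nat) (succ : V -> V).
Variables (lam bet : nat -> R).
Hypothesis tree : one_ended_tree d len succ.
Local Notation H := (V -> R[i]).
Implicit Types (f g h : H).

Definition children x : seq V := fset_set (predecessors succ x).

Lemma predecessors_finite x : finite_set (predecessors succ x).
Proof.
have [x0|/(tree_predecessors tree)E] := posnP (len x).
  by rewrite (tree_origins tree x0).
by exists d.
Qed.

Lemma children_uniq x : uniq (children x).
Proof. exact: fset_uniq. Qed.

Lemma mem_children x y : (y \in children x) = (succ y == x).
Proof.
rewrite in_fset_set; last exact: predecessors_finite.
by apply/idP/eqP => [/set_mem|yx]; [|rewrite inE].
Qed.

Lemma size_children x : size (children x) = if (len x == 0)%N then 0%N else d.
Proof.
case: eqP => [x0|/eqP]; first by rewrite /children (tree_origins tree x0) fset_set0.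
by rewrite -lt0n => /(tree_predecessors tree)/card_fset_set.
Qed.

Lemma children_succ x y : (y \in children x) -> len x = (len y).+1.
Proof. by rewrite mem_children => /eqP <-; exact: tree_len_succ tree _. Qed.

(** The target [K] is left general because the sum is taken both of complex functions and of their
    real squared moduli. *)
Definition predsum (K : nmodType) (g : V -> K) x := \sum_(y <- children x) g y.

(** The matrix of J read by rows, whereas [jacobi_basis] gives its columns. Each vertex has finitely
    many neighbours, so no summability of [g] is required. *)
Definition formal_jacobi g x : R[i] :=
  (lam_pred lam (len x))%:C * predsum g x + (bet (len x))%:C * g x
  + (lam (len x))%:C * g (succ x).

Local Notation jb := (jacobi_basis len succ lam bet).
Local Notation jf := (jacobi_fun len succ lam bet).

Lemma jacobi_basisE x : jb x =
  (lam_pred lam (len x))%:C *: (\sum_(y <- children x) delta y)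
  + (bet (len x))%:C *: delta x + (lam (len x))%:C *: delta (succ x).
Proof. by rewrite /jacobi_basis fsbig_finite//; exact: predecessors_finite. Qed.

Lemma sum_children_eq (K : nmodType) x z (c : K) :
  \sum_(y <- children x) (if y == z then c else 0) = if succ z == x then c else 0.
Proof. by rewrite sum_uniq_eq ?children_uniq// mem_children. Qed.

(** Rows and columns agree: the edge from a vertex to its successor carries the same coefficient
    seen from either end, since the successor is longer by exactly 1. *)
Lemma formal_jacobi_delta x : formal_jacobi (delta x) = jb x.
Proof.
have natb (b : bool) : (if b then 1 else 0) = b%:R :> R[i] by case: b.
apply/funext => z; rewrite jacobi_basisE /formal_jacobi /predsum.
rewrite (_ : \sum_(y <- children z) delta x y = (succ x == z)%:R); last first.
  rewrite -natb -sum_children_eq; apply: eq_bigr => y _.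
  by rewrite /delta; case: eqP.
rewrite !fctE /=.
have -> : (\sum_(y <- children x) delta y : H) z = (succ z == x)%:R.
  rewrite fct_sumE -natb -sum_children_eq; apply: eq_bigr => y _.
  by rewrite /delta eq_sym; case: eqP.
rewrite /delta (eq_sym z (succ x)).
have e1 : (lam_pred lam (len z))%:C * (succ x == z)%:R =
    (lam (len x))%:C * (succ x == z)%:R.
  by case: eqVneq => [<-|_]; rewrite ?mulr0// (tree_len_succ tree).
have e2 : (lam_pred lam (len x))%:C * (succ z == x)%:R =
    (lam (len z))%:C * (succ z == x)%:R.
  by case: eqVneq => [<-|_]; rewrite ?mulr0// (tree_len_succ tree).
have e3 : (bet (len z))%:C * (z == x)%:R = (bet (len x))%:C * (z == x)%:R.
  by case: eqVneq => [<-|_]; rewrite ?mulr0.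
rewrite /GRing.scale/= e1 e2 e3; ring.
Qed.

Lemma formal_jacobi_linear a f g :
  formal_jacobi (a *: f + g) = a *: formal_jacobi f + formal_jacobi g.
Proof.
apply/funext => x; rewrite /formal_jacobi/predsum !fctE [X in _ * X + _ + _](_ : _ =
    a * (\sum_(y <- children x) f y) + \sum_(y <- children x) g y).
  by rewrite /GRing.scale/=; ring.
by rewrite mulr_sumr -big_split.
Qed.

Lemma jacobi_funE f : jacobi_domain f -> jf f = formal_jacobi f.
Proof.
have D s : jacobi_domain (\sum_(p <- s) p.1 *: delta p.2 : H) by exists s.
(* [jacobi_fun] is known to be linear only on the domain, so its value at 0 is obtained from the
   combination [-1 *: 0 + 0]. *)
have z0 (F : H -> H) : (forall a f g, jacobi_domain f -> jacobi_domain g ->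
    F (a *: f + g) = a *: F f + F g) -> F 0 = 0.
  move=> lin; have D0 : jacobi_domain (0 : H) by exists [::]; rewrite big_nil.
  by have := lin (-1) 0 0 D0 D0; rewrite scaler0 addr0 scaleN1r addNr.
move=> [s ->]; elim: s => [|p s IH].
  rewrite big_nil !z0// => *; first exact: formal_jacobi_linear.
  exact: jacobi_fun_linear.
rewrite big_cons formal_jacobi_linear -IH.
rewrite jacobi_fun_linear// ?jacobi_fun_delta ?formal_jacobi_delta//.
exact: jacobi_domain_delta.
Qed.

Lemma l2_sum_delta (s : seq V) : l2 (\sum_(y <- s) delta y : H).
Proof. by apply: l2_sum => y; exact: l2_delta. Qed.

Lemma l2_jacobi_basis x : l2 (jb x).
Proof.
rewrite jacobi_basisE; have := l2_sum_delta (children x).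
move: (\sum_(y <- _) _) => S Sl.
by apply: l2D; [apply: l2D|]; apply: l2Z => //; exact: l2_delta.
Qed.

Lemma l2dot_jacobi_basis x g : l2 g -> l2dot (jb x) g = (formal_jacobi g x)^*.
Proof.
move=> gl; have dl y : l2 (delta y : H) by exact: l2_delta.
have predE : l2dot (\sum_(y <- children x) delta y : H) g = (predsum g x)^*.
  rewrite l2dot_suml// rmorph_sum.
  by apply: eq_bigr => y _; exact: l2dot_delta.
rewrite jacobi_basisE; move: (l2_sum_delta (children x)) predE.
move: (\sum_(y <- _) _) => S Sl predE.
have Zl c (f : H) : l2 f -> l2 (c *: f) by exact: l2Z.
rewrite (l2dotDl (l2D (Zl _ _ Sl) (Zl _ _ (dl x))) (Zl _ _ (dl (succ x))) gl).
rewrite (l2dotDl (Zl _ _ Sl) (Zl _ _ (dl x)) gl).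
rewrite (l2dotZl _ Sl gl) !(l2dotZl _ (dl _) gl) predE !l2dot_delta /formal_jacobi.
by rewrite !rmorphD !rmorphM /= !oppr0.
Qed.

Lemma formal_jacobi_sum_delta s :
  formal_jacobi (\sum_(p <- s) p.1 *: delta p.2) = \sum_(p <- s) p.1 *: jb p.2.
Proof.
elim: s => [|p s IH].
  2: by rewrite !big_cons formal_jacobi_linear IH formal_jacobi_delta.
have := formal_jacobi_linear (-1) 0 0.
by rewrite scaler0 addr0 scaleN1r addNr !big_nil.
Qed.

Lemma l2_formal_jacobi f : jacobi_domain f -> l2 (formal_jacobi f).
Proof.
move=> [s ->]; rewrite formal_jacobi_sum_delta.
by apply: l2_sum => p; apply: l2Z; exact: l2_jacobi_basis.
Qed.

(** Green's formula; as [f] is finitely supported, it reduces to the pairing of each [jacobi_basis]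
    vector with [g]. *)
Lemma l2dot_formal_jacobi f g :
  jacobi_domain f -> l2 g -> l2 (formal_jacobi g) ->
  l2dot (formal_jacobi f) g = l2dot f (formal_jacobi g).
Proof.
move=> [s ->] gl jl; rewrite formal_jacobi_sum_delta.
rewrite (l2dot_suml _ (fun p => l2Z p.1 (l2_jacobi_basis p.2)) gl).
rewrite (l2dot_suml _ (fun p => l2Z p.1 (l2_delta R p.2)) jl).
apply: eq_bigr => p _.
rewrite (l2dotZl _ (l2_jacobi_basis _) gl) (l2dotZl _ (l2_delta _ _) jl).
by rewrite l2dot_jacobi_basis// l2dot_delta.
Qed.

Local Notation J := (jacobi len succ lam bet).

Lemma jacobi_l2 fk : J fk -> l2 fk.1 /\ l2 fk.2.
Proof.
move=> [f fD <-] /=; split; first exact: jacobi_domain_l2.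
by rewrite jacobi_funE//; exact: l2_formal_jacobi.
Qed.

Lemma jacobi_sub_adjoint : J `<=` op_adjoint J.
Proof.
move=> fk Jfk; have [fl kl] := jacobi_l2 Jfk; split => //.
move: Jfk => [f fD E] _ [g gD <-]; rewrite -E /= in fl kl *.
rewrite !jacobi_funE// in kl *; exact: l2dot_formal_jacobi.
Qed.

(** Testing the adjoint identity on [delta x] reads off the value at [x]. *)
Lemma op_adjoint_formal_jacobi gh : op_adjoint J gh -> gh.2 = formal_jacobi gh.1.
Proof.
move=> [gl hl adj]; apply/funext => x.
have Jx : J (delta x, jf (delta x)).
  by exists (delta x) => //; exact: jacobi_domain_delta.
have := adj _ Jx; rewrite /= l2dot_delta jacobi_fun_delta l2dot_jacobi_basis//.
by move=> /(can_inj (@conjcK R)) ->.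
Qed.

Lemma densely_defined_jacobi_subset (T : set (H * H)) :
  J `<=` T -> densely_defined T.
Proof.
move=> JT g gl e e0; have [//|f fD fe] := @finite_approx _ _ g (e ^+ 2) gl.
  by rewrite exprn_gt0.
exists f; last by rewrite l2norm_lt.
by exists (f, jf f) => //; apply: JT; exists f.
Qed.

End FormalJacobi.

(** * Level sums, level averages and the cutoff *)

Section Averages.
Variables (R : realType) (d : nat) (V : choiceType).
Variables (len : V -> nat) (succ : V -> V).
Hypothesis tree : one_ended_tree d len succ.
Local Notation H := (V -> R[i]).
Local Notation P := (@predsum V succ _).

Lemma len_iter_succ k y : len (iter k succ y) = (len y + k)%N.
Proof.
by elim: k => [|k IH]; rewrite ?addn0// iterS (tree_len_succ tree) IH addnS.
Qed.

Lemma predsum_level (K : pzRingType) (phi : nat -> K) g x :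
  P (fun y => phi (len y) * g y) x = phi (len x).-1 * P g x.
Proof.
rewrite /predsum mulr_sumr big_seq [RHS]big_seq.
by apply: eq_bigr => y /(children_succ tree) ->.
Qed.

(** The [k]-fold sum at [x] only meets vertices of length [len x - k]. For [k] larger than [len x]
    it is empty, so the truncated subtraction does no harm. *)
Lemma iter_predsum_level (K : pzRingType) (phi : nat -> K) k g x :
  iter k P (fun y => phi (len y) * g y) x = phi (len x - k)%N * iter k P g x.
Proof.
elim: k x => [|k IH] x; first by rewrite subn0.
rewrite !iterS -(_ : (len x).-1 - k = len x - k.+1)%N; last lia.
rewrite -(predsum_level (fun n => phi (n - k)%N)).
by congr predsum; apply/funext.
Qed.

Lemma predsumZD (K : pzRingType) (a : K) f g x :
  P (fun y => a * f y + g y) x = a * P f x + P g x.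
Proof. by rewrite /predsum big_split/= mulr_sumr. Qed.

Lemma iter_predsumZD (K : pzRingType) (a : K) k f g x :
  iter k P (fun y => a * f y + g y) x = a * iter k P f x + iter k P g x.
Proof.
elim: k x => [//|k IH] x; rewrite !iterS -predsumZD.
by congr predsum; apply/funext.
Qed.

(** All predecessors of [x] share the successor [x], so its value is counted once for each of
    them. *)
Lemma predsum_succ (K : pzRingType) (g : V -> K) x :
  P (g \o succ) x = (if len x == 0 then 0 else d)%:R * g x.
Proof.
rewrite /predsum big_seq (eq_bigr (fun=> g x)) => [|y]; last first.
  by rewrite (mem_children tree) => /eqP <-.
by rewrite -big_seq sumr_const_seq (size_children tree) mulr_natl.
Qed.

Lemma iter_predsum_const (K : pzRingType) (c : K) k x : (k <= len x)%N ->
  iter k P (fun=> c) x = (d ^ k)%:R * c.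
Proof.
elim: k x => [|k IH] x kx; first by rewrite mul1r.
rewrite iterS /predsum big_seq (eq_bigr (fun=> (d ^ k)%:R * c)) => [|y yx].
  2: by apply: IH; rewrite (children_succ tree yx) in kx.
rewrite -big_seq sumr_const_seq (size_children tree).
by case: eqP => [x0|_]; [lia|rewrite expnS natrM -mulrA [RHS]mulr_natl].
Qed.

Lemma iter_predsum_delta k p x :
  iter k P (delta p : H) x = (iter k succ p == x)%:R.
Proof.
have natb (b : bool) : (if b then 1 else 0) = b%:R :> R[i] by case: b.
elim: k x => [|k IH] x; first by rewrite /delta eq_sym.
rewrite !iterS -natb -(sum_children_eq tree).
by apply: eq_bigr => y _; rewrite IH eq_sym -natb.
Qed.

Lemma sqn_sum_le (T : Type) (s : seq T) (F : T -> R[i]) :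
  sqn (\sum_(i <- s) F i) <= (size s)%:R * \sum_(i <- s) sqn (F i).
Proof.
rewrite sqnE !raddf_sum/=.
under [in leRHS]eq_bigr do rewrite sqnE.
by rewrite big_split mulrDr lerD// sqr_sum_le.
Qed.

(** Cauchy-Schwarz once per level, each time over at most [d] children. *)
Lemma sqn_iter_predsum_le k (g : H) x :
  sqn (iter k P g x) <= (d ^ k)%:R * iter k P (fun y => sqn (g y)) x.
Proof.
elim: k x => [|k IH] x; first by rewrite mul1r.
rewrite !iterS; apply: le_trans (sqn_sum_le _ _) _.
rewrite expnS natrM -mulrA ler_pM//.
- by apply: sumr_ge0 => y _; exact: sqn_ge0.
- by rewrite ler_nat (size_children tree); case: ifP.
- by rewrite mulr_sumr; apply: ler_sum => y _.
Qed.

Definition descendants k x : set V := [set y | iter k succ y = x].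

(** Bridges the finite iterated sums and the [esum] of the norm. In the induction, each vertex
    [k.+1] levels below [x] passes through exactly one child of [x]. *)
Lemma esum_descendants k (w : V -> R) x : (forall y, 0 <= w y) ->
  (\esum_(y in descendants k x) (w y)%:E = (iter k P w x)%:E)%E.
Proof.
move=> w0; elim: k x => [|k IH] x.
  by rewrite (_ : descendants 0 x = [set x]) ?esum_set1 ?lee_fin.
rewrite iterS /predsum -sumEFin.
under eq_bigr do rewrite -IH esum_mkcond.
rewrite -esum_sum => [|y z _ _]; last by case: ifP => // _; rewrite lee_fin.
rewrite esum_mkcond; apply: eq_esum => y _.
transitivity
  (\sum_(z <- children succ x) (if z == iter k succ y then w y else 0))%:E.
  rewrite (sum_children_eq tree) -iterS.
  by case: eqP => E; [rewrite mem_set|rewrite memNset].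
rewrite -sumEFin; apply: eq_bigr => z _.
by case: eqP => E; [rewrite mem_set|rewrite memNset// => /esym].
Qed.

Lemma descendants_finite k x : finite_set (descendants k x).
Proof.
elim: k x => [|k IH] x; first exact: finite_set1.
rewrite (_ : descendants _ _ = \bigcup_(z in predecessors succ x) descendants k z).
  by apply: bigcup_finite => [|z _]; [exact: (predecessors_finite tree)|exact: IH].
apply/seteqP; split => [y yx|y [z zx /= yz]]; first by exists (iter k succ y).
by rewrite /descendants/= yz.
Qed.

Lemma descendants_empty k x : (len x < k)%N -> descendants k x = set0.
Proof.
move=> xk; apply/seteqP; split => // y /= yx.
by move: xk; rewrite -yx len_iter_succ; lia.
Qed.

(** Lengths force the number of successor steps from [y] to [x], which makes the relation decidable.
    If [y] is longer than [x], the truncated difference is 0 and the test fails because [y] differs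
    from [x]. *)
Definition below x y := iter (len x - len y) succ y == x.

Lemma belowP x y : reflect (descendants (len x - len y) x y) (below x y).
Proof. exact: eqP. Qed.

Lemma descendants_len k x y : descendants k x y -> (len x - len y = k)%N.
Proof. by move=> <-; rewrite len_iter_succ; lia. Qed.

Lemma descendants_below k x y : descendants k x y -> below x y.
Proof. by move=> Dy; apply/belowP; rewrite (descendants_len Dy). Qed.

Lemma below_len x y : below x y -> (len y <= len x)%N.
Proof.
by move=> /eqP E; have := len_iter_succ (len x - len y) y; rewrite E; lia.
Qed.

Lemma below_refl x : below x x.
Proof. by rewrite /below subnn. Qed.

Lemma below_child x y z : below x y -> z \in children succ y -> below x z.
Proof.
rewrite (mem_children tree) => /belowP xy /eqP zy.
apply: (@descendants_below (len x - len y).+1).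
by rewrite /descendants/= -iterS iterSr zy.
Qed.

Lemma below_succ x y : below x y -> y != x -> below x (succ y).
Proof.
move=> /belowP; case: (len x - len y)%N => [|k] xy yx.
  by move: yx; rewrite -xy eqxx.
by apply: (@descendants_below k); rewrite /descendants/= -iterSr.
Qed.

Lemma not_below_succ x y : ~~ below x y -> ~~ below x (succ y).
Proof.
apply: contra => /belowP; set k := (_ - _)%N => xy.
by apply: (@descendants_below k.+1); rewrite /descendants/= -iterS iterSr.
Qed.

Lemma not_below_self_succ x : ~~ below x (succ x).
Proof. by apply/negP => /below_len; rewrite (tree_len_succ tree); lia. Qed.

Lemma below_finite x : finite_set [set y | below x y].
Proof.
apply: (@sub_finite_set _ _ (\bigcup_(k in `I_(len x).+1) descendants k x)).
  by move=> y /= /belowP; exists (len x - len y)%N => //=; rewrite ltnS leq_subr.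
by apply: bigcup_finite => // k _; exact: descendants_finite.
Qed.

(* [iter k P g x] is the sum of g over the d ^ k vertices k levels below x. *)
Definition avg x (g : H) y : R[i] :=
  let k := (len x - len y)%N in (d%:R ^+ k)^-1 * iter k P g x.

(** The operator C_x. The test is essential, because [avg] also takes values at vertices outside the
    subtree. *)
Definition cutoff x g y : R[i] := if below x y then g y - avg x g y else 0.

(** The complement 1 - C_x. *)
Definition resid x g y : R[i] := if below x y then avg x g y else g y.

Lemma sub_cutoff x g : g - cutoff x g = resid x g.
Proof.
apply/funext => y; rewrite !fctE /cutoff /resid.
by case: ifP => _; rewrite ?subr0// opprB addrC subrK.
Qed.

Lemma cutoff_domain x g : jacobi_domain (cutoff x g).
Proof.
apply/jacobi_domainP; apply: sub_finite_set (below_finite x) => y /=.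
by rewrite /cutoff; case: ifP => //; rewrite eqxx.
Qed.

Variables (lam bet : nat -> R).
Local Notation formal_jacobi := (formal_jacobi len succ lam bet).

(** Summed over level [k], the three terms of the action turn into the sums over levels [k.+1], [k]
    and [k.-1]; each vertex of the last is reached from its [d] predecessors. For [k = 0] the
    successor term would leave the subtree. *)
Lemma iter_predsum_formal_jacobi k g x : (0 < k)%N -> (k <= len x)%N ->
  iter k P (formal_jacobi g) x = (lam_pred lam (len x - k))%:C * iter k.+1 P g x
    + (bet (len x - k))%:C * iter k P g x
    + (lam (len x - k))%:C * (d%:R * iter k.-1 P g x).
Proof.
move=> k0 kx; rewrite /formal_jacobi.
have E (f1 f2 f3 : H) : iter k P (fun y => f1 y + f2 y + f3 y) x =
    iter k P f1 x + iter k P f2 x + iter k P f3 x.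
  have D (h1 h2 : H) : iter k P (fun y => h1 y + h2 y) x =
      iter k P h1 x + iter k P h2 x.
    rewrite (_ : (fun y => _) = fun y => 1 * h1 y + h2 y).
      by rewrite iter_predsumZD mul1r.
    by apply/funext => y; rewrite mul1r.
  by rewrite (D (fun y => f1 y + f2 y)) D.
rewrite E (iter_predsum_level (fun n => (lam_pred lam n)%:C)).
rewrite (iter_predsum_level (fun n => (bet n)%:C)).
rewrite (iter_predsum_level (fun n => (lam n)%:C)) -iterSr.
congr (_ + _ + _ * _).
case: k k0 kx {E} => // k _ kx; rewrite iterSr /=.
rewrite (_ : P _ = fun y => (if len y == 0 then 0 else d)%:R * g y); last first.
  by apply/funext => y; rewrite -predsum_succ.
(* Here [k] is one less than in the statement, so [len x - k] is positive and the vertices at this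
   level do have [d] predecessors. *)
rewrite (iter_predsum_level (fun n => (if n == 0 then 0 else d)%:R)).
by case: eqP => //; lia.
Qed.

(** Level averaging turns the action into a recursion in the level alone, with the same
    coefficients, so it can only fail to commute at the boundary of the subtree. There the cutoff
    vanishes at [x] and sums to 0 over the children of [x]. *)
Lemma formal_jacobi_cutoff x g : (0 < d)%N ->
  formal_jacobi (cutoff x g) = cutoff x (formal_jacobi g).
Proof.
move=> d0; apply/funext => y; rewrite {2}/cutoff.
have dn0 : (d%:R : R[i]) != 0 by rewrite pnatr_eq0 -lt0n.
case: ifPn => xy; last first.
  rewrite /formal_jacobi {2 3}/cutoff (negbTE xy) (negbTE (not_below_succ xy)).
  rewrite !mulr0 !addr0.
  rewrite /predsum big_seq big1 ?mulr0// => z.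
  rewrite (mem_children tree) => /eqP zy.
  (* The only child of [y] that can lie below [x] is [x] itself, where the average is the value
     [g x] and the cutoff is 0. *)
  rewrite /cutoff; case: ifP => // xz; case: (eqVneq z x) => [->|zx].
    by rewrite /avg subnn expr0 invr1 mul1r subrr.
  by move: (below_succ xz zx); rewrite zy (negbTE xy).
have yx := below_len xy; set k := (len x - len y)%N.
(* The averages at the [d] children of [y] add up to [d * d ^- k.+1 = d ^- k] times the level sum.
   The coefficient is kept in front because at length 0 there are no children, and it is then 0. *)
have predE : (lam_pred lam (len y))%:C * P (cutoff x g) y =
    (lam_pred lam (len y))%:C *
    (P g y - (d%:R ^+ k)^-1 * iter k.+1 P g x).
  have -> : P (cutoff x g) y = P g y -
      (if len y == 0 then 0 else d)%:R * ((d%:R ^+ k.+1)^-1 * iter k.+1 P g x).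
    rewrite /predsum -(size_children tree) mulr_natl -sumr_const_seq -sumrB.
    rewrite big_seq [RHS]big_seq; apply: eq_bigr => z zy.
    rewrite /cutoff (below_child xy zy) /avg; have := children_succ tree zy => lyz.
    by rewrite (_ : len x - len z = k.+1)%N //; lia.
  case: eqP => [->|_]; first by rewrite !mul0r.
  by congr (_ * (_ - _)); rewrite exprS; field; rewrite expf_neq0.
(* At [x] itself both sides vanish, the successor lying outside the subtree. *)
case: (eqVneq y x) => [yxE|ynx].
  rewrite {1}/formal_jacobi predE /cutoff yxE below_refl.
  rewrite (negbTE (not_below_self_succ x)).
  rewrite /avg /k yxE subnn expr0 invr1 !mul1r !subrr mulr0; ring.
have k0 : (0 < k)%N.
  rewrite lt0n; apply: contraNneq ynx => k0.
  by move: xy; rewrite /below -/k k0.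
(* Above [y] the factor [d] of the level sum turns [d ^- k] into [d ^- k.-1], the normalization of
   the average at [succ y]. *)
rewrite {1}/formal_jacobi predE /cutoff xy (below_succ xy ynx) /avg -/k.
rewrite (tree_len_succ tree) subnS -/k iter_predsum_formal_jacobi ?leq_subr//.
rewrite (_ : len x - k = len y)%N; last by rewrite /k; lia.
rewrite /formal_jacobi -{1 3 5 7}(prednK k0) exprS.
by field; rewrite expf_neq0.
Qed.

End Averages.

(** * Contraction and strong convergence along a ray *)

Section Convergence.
Variables (R : realType) (d : nat) (V : choiceType).
Variables (len : V -> nat) (succ : V -> V).
Hypothesis d2 : (2 <= d)%N.
Hypothesis tree : one_ended_tree d len succ.
Local Notation H := (V -> R[i]).
Local Notation P := (@predsum V succ _).
Local Notation avg := (@avg R d V len succ).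
Local Notation descendants := (descendants succ).
Local Notation below := (below len succ).
Local Notation resid := (@resid R d V len succ).
Implicit Types g h : H.

Let d_gt0 : (0 < d)%N.
Proof. exact: ltnW. Qed.

Lemma sqn_avg x g y : sqn (avg x g y) =
  (d%:R ^- (len x - len y)) ^+ 2 * sqn (iter (len x - len y) P g x).
Proof.
rewrite /avg sqnM; congr (_ * _).
have -> : (d%:R ^+ (len x - len y))^-1 = (d%:R ^- (len x - len y))%:C :> R[i].
  by rewrite fmorphV rmorphXn rmorph_nat.
by rewrite sqnE/= expr0n addr0.
Qed.

(** On a level the residual is constant with squared modulus [d ^- (2 * k)] times that of the level
    sum; over [d ^ k] vertices this makes [d ^- k], which absorbs the factor in
    [sqn_iter_predsum_le]. *)
Lemma esum_descendants_resid_le k x g :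
  (\esum_(y in descendants k x) (sqn (resid x g y))%:E <=
   \esum_(y in descendants k x) (sqn (g y))%:E)%E.
Proof.
have [xk|kx] := ltnP (len x) k.
  by rewrite (descendants_empty tree)// !esum_set0.
pose c := (d%:R ^- k) ^+ 2 * sqn (iter k P g x) : R.
rewrite (_ : \esum_(y in _) (sqn (resid x g y))%:E =
    \esum_(y in descendants k x) c%:E).
  rewrite !(esum_descendants tree)//.
  3: by move=> y; rewrite mulr_ge0 ?sqn_ge0 ?sqr_ge0.
    rewrite lee_fin (iter_predsum_const tree)// /c mulrA.
    rewrite natr_mul_invX_sqr// ler_pdivrMl ?exprn_gt0 ?ltr0n//.
    by rewrite -natrX (sqn_iter_predsum_le tree).
  by move=> y; exact: sqn_ge0.
apply: eq_esum => y Dy; congr EFin.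
by rewrite /resid (descendants_below tree Dy) sqn_avg (descendants_len tree Dy).
Qed.

(** The levels below [x] are disjoint and estimated one by one; off their union the residual is
    [g]. *)
Lemma nsq_resid_le x g : (nsq (resid x g) <= nsq g)%E.
Proof.
have pos h y : (0 <= (sqn (h y))%:E)%E by rewrite lee_fin sqn_ge0.
have disj : trivIset setT (fun k => descendants k x).
  move=> i j _ _ [y [/(descendants_len tree) <- /(descendants_len tree)<-]].
  by [].
pose G := \bigcup_(k in setT) descendants k x.
rewrite /nsq /tot (esumID G) ?[leRHS](esumID G)//; try by move=> *; exact: pos.
rewrite !setTI; apply: leeD.
  rewrite !esum_bigcupT//; try by move=> *; exact: pos.
  by apply: le_esum => k _; exact: esum_descendants_resid_le.
apply: le_esum => y Gy; rewrite /resid; case: ifPn => // /belowP xy.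
by case: Gy; exists (len x - len y)%N.
Qed.

(** The residual spreads the unit mass at [p] evenly over the [d ^ k] vertices of its level. *)
Lemma nsq_resid_delta x p : below x p ->
  nsq (resid x (delta p)) = (d%:R ^- (len x - len p))%:E.
Proof.
move=> xp; set k := (len x - len p)%N.
have kx : (k <= len x)%N by exact: leq_subr.
pose c := (d%:R ^- k) ^+ 2 : R.
transitivity (\esum_(y in descendants k x) c%:E)%E.
  rewrite [RHS]esum_mkcond; apply: eq_esum => y _; rewrite /resid.
  case: ifPn => [xy|nxy]; last first.
    rewrite memNset => [|Dy]; last by rewrite (descendants_below tree Dy) in nxy.
    rewrite /delta; case: eqVneq => [yp|_]; last by rewrite sqn0.
    by rewrite yp xp in nxy.
  rewrite sqn_avg (iter_predsum_delta R tree) sqn_natr.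
  have Dp : iter k succ p = x by apply/eqP.
  case: ifPn => [/set_mem Dy|/negP ny].
    by rewrite (descendants_len tree Dy) Dp eqxx expr1n mulr1.
  case: eqP => [E|_]; last by rewrite expr0n mulr0.
  case: ny; apply/mem_set; rewrite /k (descendants_len tree E).
  by move/eqP: xy.
rewrite (esum_descendants tree) => [|y]; last exact: sqr_ge0.
by rewrite (iter_predsum_const tree)// natr_mul_invX_sqr.
Qed.

Lemma residZD x a g h : resid x (a *: g + h) = a *: resid x g + resid x h.
Proof.
apply/funext => y; rewrite !fctE /resid; case: ifP => // _.
by rewrite /avg iter_predsumZD mulrDr /GRing.scale/= mulrCA.
Qed.

Lemma resid0 x : resid x 0 = 0.
Proof.
have := residZD x (-1) 0 0.
by rewrite scaler0 addr0 scaleN1r addNr.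
Qed.

Variable o : V.
Local Notation ray n := (iter n succ o).

Definition resid_cvg g := forall e : R, 0 < e ->
  exists N, forall n, (N <= n)%N -> (nsq (resid (ray n) g) < e%:E)%E.

Lemma common_successor p : exists a b, iter a succ o = iter b succ p.
Proof.
have [q] := tree_connected tree o p.
(* Having a common iterated successor with [o] is propagated along the path: a step up adds one
   successor on the side of [o], a step down one on the other side. *)
suff : forall z, (exists a b, iter a succ o = iter b succ z) ->
    path (tree_edge succ) z q -> last z q = p ->
    exists a b, iter a succ o = iter b succ p.
  by apply; exists 0, 0.
elim: q => [|w q IH] z [a [b ab]] /=; first by move=> _ <-; exists a, b.
move=> /andP[zw wq]; apply: IH wq; move: zw => /orP[/eqP wz|/eqP zw].
  by exists a.+1, b; rewrite iterS ab wz -iterS iterSr.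
by exists a, b.+1; rewrite ab zw iterSr.
Qed.

Lemma below_ray p : exists a b, forall n, (a <= n)%N ->
  iter (n - a + b) succ p = ray n.
Proof.
have [a [b ab]] := common_successor p; exists a, b => n an.
by rewrite iterD -ab -iterD subnK.
Qed.

Lemma resid_cvg_delta p : resid_cvg (delta p).
Proof.
move=> e e0; have [a [b abP]] := below_ray p.
(* With exponent [k = n - a + b], the chain is [e^-1 < M <= k < 2 ^ k <= d ^ k]. The extra successor
   in the threshold keeps [k] positive, as the comparison of bases requires. *)
pose M := Num.bound e^-1; exists (a + M).+1 => n Mn.
have Dp : descendants (n - a + b) (ray n) p by apply: abP; lia.
rewrite nsq_resid_delta ?(descendants_below tree Dp)// (descendants_len tree Dp).
rewrite lte_fin invf_plt ?posrE ?exprn_gt0 ?ltr0n//.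
have : e^-1 < M%:R by rewrite /M archi_boundP// invr_ge0 ltW.
move=> /lt_le_trans; apply; rewrite -natrX ler_nat.
apply: (@leq_trans (2 ^ (n - a + b))); last by rewrite leq_exp2r//; lia.
by apply: leq_trans (ltnW (ltn_expl _ _)) => //; lia.
Qed.

Lemma resid_cvgD g h : resid_cvg g -> resid_cvg h -> resid_cvg (g + h).
Proof.
move=> gc hc e e0; have e4 : 0 < e / 4 by rewrite divr_gt0.
have [[M Mg] [N Nh]] := (gc _ e4, hc _ e4); exists (M + N)%N => n MNn.
rewrite -[g]scale1r residZD scale1r.
apply: le_lt_trans (nsqD_le _ _) _.
have {}Mg := Mg n (leq_trans (leq_addr _ _) MNn).
have {}Nh := Nh n (leq_trans (leq_addl _ _) MNn).
have -> : (e%:E = 2%:E * (e / 4)%:E + 2%:E * (e / 4)%:E)%E.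
  by rewrite -!EFinM -EFinD; congr EFin; field.
by rewrite lteD// lte_pmul2l.
Qed.

Lemma resid_cvgZ a g : resid_cvg g -> resid_cvg (a *: g).
Proof.
(* Adding 1 avoids a division by zero when [a = 0]. *)
move=> gc e e0; have a0 : 0 < sqn a + 1 by rewrite ltr_wpDl ?sqn_ge0.
have [N Ng] := gc _ (divr_gt0 e0 a0); exists N => n /Ng {}Ng.
rewrite -[a *: g]addr0 residZD resid0 addr0.
rewrite nsqZ; move: Ng; have := nsq_ge0 (resid (ray n) g).
case: (nsq _) => [r||]//; rewrite lee_fin -EFinM !lte_fin => r0 re.
have := sqn_ge0 a; move: (sqn a) a0 re => s s0; rewrite ltr_pdivlMr// => re ss.
by apply: le_lt_trans re; rewrite mulrDr mulr1 mulrC lerDl.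
Qed.

(** Finite combinations of [delta] are dense and the residuals are contractions uniformly in [n], so
    convergence on the former suffices. *)
Lemma resid_cvg_l2 g : l2 g -> resid_cvg g.
Proof.
move=> gl e e0; have e4 : 0 < e / 4 by rewrite divr_gt0.
have [f fD gf] := finite_approx gl e4.
have fc : resid_cvg f.
  move: fD => [s ->]; apply: big_ind => [|*|p _]; last 1 first.
  - exact: resid_cvgZ (resid_cvg_delta _).
  - by rewrite -(scale0r (delta o)); exact: resid_cvgZ (resid_cvg_delta _).
  - exact: resid_cvgD.
have [N Nf] := fc _ e4; exists N => n /Nf {}Nf.
rewrite -[g](subrK f) -[g - f]scale1r residZD scale1r.
apply: le_lt_trans (nsqD_le _ _) _.
have -> : (e%:E = 2%:E * (e / 4)%:E + 2%:E * (e / 4)%:E)%E.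
  by rewrite -!EFinM -EFinD; congr EFin; field.
rewrite lteD// lte_pmul2l//.
exact: le_lt_trans (nsq_resid_le _ _) gf.
Qed.

End Convergence.

Theorem theorem2p4 (R : realType) (d : nat)
    (V : choiceType) (len : V -> nat) (succ : V -> V)
    (lam bet : nat -> R) :
  (2 <= d)%N -> one_ended_tree d len succ -> (forall n, 0 < lam n) ->
  essentially_selfadjoint (jacobi len succ lam bet).
Proof.
move=> d2 tree _; set J := jacobi _ _ _ _.
have Jl2 := @jacobi_l2 R d V len succ lam bet tree.
have Jsym := @jacobi_sub_adjoint R d V len succ lam bet tree.
have JclJ := op_closureS Jl2.
split; first by split=> //; apply: densely_defined_jacobi_subset (@subset_refl _ J).
split; first exact: densely_defined_jacobi_subset JclJ.
apply/seteqP; split; first exact: op_closure_sub_adjoint.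
rewrite op_adjoint_closure// => -[g h] Jgh; have [/= gl hl _] := Jgh.
have /= hE := op_adjoint_formal_jacobi tree Jgh.
split => //= e e0; have e20 : 0 < e ^+ 2 by rewrite exprn_gt0.
have [o _] := tree_nonempty tree.
have [M Mg] := resid_cvg_l2 d2 tree o gl e20.
have [N Nh] := resid_cvg_l2 d2 tree o hl e20.
(* Far enough along the ray for both [g] and [h]. *)
set x := iter (M + N) succ o.
have cD := cutoff_domain tree x g.
exists (cutoff d len succ x g, cutoff d len succ x h) => /=.
  exists (cutoff d len succ x g) => //; congr pair.
  rewrite (jacobi_funE _ _ tree cD) hE; apply: (formal_jacobi_cutoff tree); lia.
rewrite !sub_cutoff !l2norm_lt//; split; [apply: Mg|apply: Nh]; lia.
Qed.
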